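(* Let $f=\frac1n\sum_{i=1}^n f_i$ where each $f_i:\mathbb{R}^d\to\mathbb{R}$ is convex and $L_i$-smooth, and assume that $f$ is $\mu$-strongly convex ($\mu>0$) with minimizer $x^*$. Let $L_{\max}=\max_{1\le i\le n}L_i$, let $c\ge 1/2$, $\gamma_b\in(0,\infty)$, and put $\alpha:=\min\{\frac{1}{2cL_{\max}},\gamma_b\}$. Then the iterates of SGD with $\text{SPS}_{\max}$ (with parameters $c$ and $\gamma_b$) satisfy, for all $k\ge 0$, $$\mathbb{E}\|x^{k}-x^*\|^2\le (1-\mu\alpha)^k\|x^0-x^*\|^2+\frac{2\gamma_b\sigma^2}{\mu\alpha}.$$ Moreover, among all $c\ge 1/2$, the best convergence rate and the tightest neighborhood in this bound (that is, the smallest values of $1-\mu\alpha$ and of $\frac{2\gamma_b\sigma^2}{\mu\alpha}$) are obtained for $c=1/2$.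
   Context: Setting: $f(x)=\frac1n\sum_{i=1}^n f_i(x)$ is minimized over $\mathbb{R}^d$, and the set $\mathcal{X}^*$ of minimizers of $f$ is nonempty. A function is $L$-smooth if it is differentiable with $L$-Lipschitz gradient. For each $i$, $f_i^*:=\inf_x f_i(x)$, and it is assumed throughout that $\sigma^2:=\mathbb{E}_i[f_i(x^* )-f_i^*]=f(x^* )-\frac1n\sum_{i=1}^n f_i^*<\infty$ (so all $f_i^*$ are finite), where $x^*\in\mathcal{X}^*$. SGD: starting from a deterministic $x^0$, at each iteration $k$ an index $i\in\{1,\dots,n\}$ is drawn uniformly at random, independently of the past, and $x^{k+1}=x^k-\gamma_k\nabla f_i(x^k)$. $\text{SPS}_{\max}$ with parameters $c>0$ and $\gamma_b>0$: $\gamma_k=\min\left\{\frac{f_i(x^k)-f_i^*}{c\|\nabla f_i(x^k)\|^2},\gamma_b\right\}$, where $i$ is the index drawn at iteration $k$. If $\nabla f_i(x^k)=0$ then $x^{k+1}=x^k$. *)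

(* Defs.v *)
From HB Require Import structures.
From mathcomp Require Import all_boot all_order all_algebra.
From mathcomp Require Import all_classical all_reals all_analysis.

Set Implicit Arguments.
Unset Strict Implicit.
Unset Printing Implicit Defensive.

Import Order.TTheory GRing.Theory Num.Theory.
Import numFieldNormedType.Exports.

Local Open Scope classical_set_scope.
Local Open Scope ring_scope.

Section FunctionClasses.
Context {R : realType} {d : nat}.
Implicit Types (g : 'rV[R]_d -> R) (x y : 'rV[R]_d).

(* The library norm `|x| on 'rV[R]_d is the sup norm, hence this definition. *)
Definition enorm x : R := Num.sqrt (\sum_(j < d) x 0 j ^+ 2).

Definition gradient g x : 'rV[R]_d := \row_j 'D_(delta_mx 0 j) g x.

(* [0 <= L] is automatic from the Lipschitz bound unless d = 0. *)
Definition smooth_with (L : R) g : Prop :=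
  [/\ 0 <= L,
      forall x, differentiable g x
    & forall x y, enorm (gradient g x - gradient g y) <= L * enorm (x - y)].

Definition strongly_convex (mu : R) g : Prop :=
  forall (t : R) x y, 0 <= t <= 1 ->
    g (t *: x + (1 - t) *: y)
      <= t * g x + (1 - t) * g y - mu / 2 * t * (1 - t) * enorm (x - y) ^+ 2.

Definition minimizer g x : Prop := forall y, g x <= g y.

(* Only meaningful as an infimum when [range g] is bounded below. *)
Definition infval g : R := inf (range g).

End FunctionClasses.

Section StochasticPolyak.
Context {R : realType} {d n : nat}.
Implicit Types (f : 'I_n -> 'rV[R]_d -> R) (x : 'rV[R]_d).

Definition average f x : R := n%:R^-1 * \sum_(i < n) f i x.

Definition sigma2 f x : R :=
  n%:R^-1 * \sum_(i < n) (f i x - infval (f i)).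

(* The default value 0 is harmless: smoothness constants are nonnegative. *)
Definition Lmax (L : 'I_n -> R) : R := \big[Num.max/0]_(i < n) L i.

Definition sps_alpha (c gamma_b : R) (L : 'I_n -> R) : R :=
  Num.min (1 / (2 * c * Lmax L)) gamma_b.

Definition sps_max (c gamma_b : R) (g : 'rV[R]_d -> R) x : R :=
  Num.min ((g x - infval g) / (c * enorm (gradient g x) ^+ 2)) gamma_b.

Definition sps_step (c gamma_b : R) (g : 'rV[R]_d -> R) x : 'rV[R]_d :=
  if gradient g x == 0 then x
  else x - sps_max c gamma_b g x *: gradient g x.

Fixpoint sps_sgd f (c gamma_b : R) (x0 : 'rV[R]_d) (s : nat -> 'I_n) (k : nat)
    : 'rV[R]_d :=
  if k is k'.+1 then
    sps_step c gamma_b (f (s k')) (sps_sgd f c gamma_b x0 s k')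
  else x0.

End StochasticPolyak.

(* Measurability for the discrete sigma-algebra on 'I_n, uniform marginals, and
   mutual independence. *)
Definition iid_uniform {R : realType} {disp : measure_display}
    {T : measurableType disp} (P : probability T R) {n : nat}
    (I : nat -> T -> 'I_n) : Prop :=
  [/\ forall k (A : set 'I_n), measurable (I k @^-1` A),
      forall k (i : 'I_n), P (I k @^-1` [set i]) = (n%:R^-1)%:E
    & forall (s : seq nat) (A : nat -> set 'I_n), uniq s ->
        P (\bigcap_(k in [set` s]) (I k @^-1` A k))
          = (\prod_(k <- s) P (I k @^-1` A k))%E].

(* Main.v *)
Require Import Defs.
From mathcomp Require Import all_boot all_order all_algebra.
From mathcomp Require Import all_classical all_reals all_analysis.
From mathcomp Require Import measurable_realfun ring lra.
Import Order.TTheory GRing.Theory Num.Theory.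
Import numFieldNormedType.Exports.
Local Open Scope classical_set_scope.
Local Open Scope ring_scope.

(** Write g for one summand [f i], x for the current iterate, z for the target
    [xstar], gamma for the step size, and
    D = g x - g z - <grad g x, x - z>, which is nonpositive by convexity.
    Expanding the square, the definition of gamma and 1/2 <= c give
    gamma^2 |grad g x|^2 <= 2 gamma (g x - inf g), whence
      |x+ - z|^2 <= |x - z|^2 + 2 gamma D + 2 gamma (g z - inf g).
    Smoothness gives |grad g x|^2 <= 2 Lmax (g x - inf g), so that
    alpha <= gamma <= gamma_b; as D is nonpositive and g z - inf g is
    nonnegative, the two occurrences of gamma may be replaced by alpha and by
    gamma_b respectively ([sps_step_dist]).  In that form the bound is affine
    in g: averaging over i turns D into the same expression for the average
    function, which strong convexity bounds by - mu/2 |x - z|^2.  One step thus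
    contracts the mean squared distance by the factor 1 - mu alpha up to the
    additive term 2 gamma_b sigma2 ([sps_step_contraction]).

    The iterate number k is a function of the first k draws, hence independent
    of draw number k ([chain_future_indep]); the expected squared distance
    after step k is therefore the expectation of the uniform average over i
    ([expectation_chainS]), and the one-step bound can be iterated.  The
    additive terms sum to at most 2 gamma_b sigma2 / (mu alpha).

    Iterating requires 0 <= 1 - mu alpha and 0 < alpha.  Both follow from
    mu <= Lmax, which holds as soon as the space has a nonzero vector
    ([strong_convexity_le_Lmax]).  In dimension 0 the constant Lmax may vanish,
    and then alpha = 0 because division by 0 yields 0; but all distances are 0,
    and the bound is trivial.

    The comparison between values of c holds because alpha is nonincreasing in
    c ([sps_alpha_le_half]). *)

(** * Euclidean inner product *)

Section Euclidean.
Context {R : realType} {d : nat}.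
Implicit Types (u v w : 'rV[R]_d) (a : R).

(** The Euclidean inner product of row vectors, which induces [enorm]. *)
Definition dot u v : R := \sum_(j < d) u 0 j * v 0 j.

Lemma dotC u v : dot u v = dot v u.
Proof. by apply: eq_bigr => j _; rewrite mulrC. Qed.

Lemma dotDl u v w : dot (u + v) w = dot u w + dot v w.
Proof. by rewrite -big_split; apply: eq_bigr => j _; rewrite mxE mulrDl. Qed.

Lemma dotZl a u v : dot (a *: u) v = a * dot u v.
Proof. by rewrite mulr_sumr; apply: eq_bigr => j _; rewrite mxE mulrA. Qed.

Lemma dotNl u v : dot (- u) v = - dot u v.
Proof. by rewrite -scaleN1r dotZl mulN1r. Qed.

Lemma dotDr u v w : dot w (u + v) = dot w u + dot w v.
Proof. by rewrite dotC dotDl !(dotC w). Qed.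

Lemma dotZr a u v : dot u (a *: v) = a * dot u v.
Proof. by rewrite dotC dotZl dotC. Qed.

Lemma dotNr u v : dot u (- v) = - dot u v.
Proof. by rewrite dotC dotNl dotC. Qed.

Definition dotE := (dotDl, dotDr, dotZl, dotZr, dotNl, dotNr).

Lemma dotvv_ge0 u : 0 <= dot u u.
Proof. by apply: sumr_ge0 => j _; rewrite -expr2 sqr_ge0. Qed.

Lemma dotvv_eq0 u : (dot u u == 0) = (u == 0).
Proof.
apply/idP/eqP => [|->]; last by rewrite /dot big1 // => j _; rewrite mxE mul0r.
rewrite psumr_eq0 => [/allP u0|j _]; last by rewrite -expr2 sqr_ge0.
apply/rowP => j; rewrite mxE; apply/eqP.
by have := u0 j (mem_index_enum _); rewrite -expr2 sqrf_eq0.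
Qed.

Lemma enorm_ge0 u : 0 <= enorm u.
Proof. exact: sqrtr_ge0. Qed.

Lemma sqr_enorm u : enorm u ^+ 2 = dot u u.
Proof.
by rewrite sqr_sqrtr; [|apply: sumr_ge0 => j _; rewrite sqr_ge0].
Qed.

Lemma dot_gt0 u : u != 0 -> 0 < dot u u.
Proof. by move=> u0; rewrite lt_neqAle eq_sym dotvv_eq0 u0 dotvv_ge0. Qed.

Lemma enormZ a u : enorm (a *: u) = `|a| * enorm u.
Proof.
apply/eqP; rewrite -(@eqrXn2 _ 2%N) ?mulr_ge0 ?enorm_ge0 //.
by rewrite exprMn !sqr_enorm !dotE real_normK ?num_real // mulrA.
Qed.

Lemma enormN u : enorm (- u) = enorm u.
Proof. by rewrite -scaleN1r enormZ normrN1 mul1r. Qed.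

(** Cauchy-Schwarz. *)
Lemma dot_le_enorm u v : dot u v <= enorm u * enorm v.
Proof.
have [u0|u0] := eqVneq u 0.
  by rewrite u0 -(scale0r 0) dotZl mul0r mulr_ge0 ?enorm_ge0.
have [v0|v0] := eqVneq v 0.
  by rewrite v0 -(scale0r 0) dotZr mul0r mulr_ge0 ?enorm_ge0.
have e_gt0 w : w != 0 -> 0 < enorm w.
  by move=> w0; rewrite lt0r enorm_ge0 andbT -sqrf_eq0 sqr_enorm gt_eqF ?dot_gt0.
(* Expand 0 <= | |v| u - |u| v |^2 and divide by 2 |u| |v|. *)
have uv_gt0 : 0 < enorm u * enorm v by rewrite mulr_gt0 ?e_gt0.
have := dotvv_ge0 (enorm v *: u - enorm u *: v).
rewrite !dotE (dotC v u) -!sqr_enorm => h.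
rewrite -(ler_pM2l uv_gt0); nra.
Qed.

End Euclidean.

(** * First-order inequalities *)

Section Differential.
Context {R : realType} {d : nat}.
Implicit Types (g : 'rV[R]_d -> R) (x y v : 'rV[R]_d).

Lemma derive_gradient g x v : differentiable g x -> 'D_v g x = dot (gradient g x) v.
Proof.
move=> dg; rewrite deriveE // {1}(row_sum_delta v) linear_sum; apply: eq_bigr => j _.
by rewrite linearZ /= mxE deriveE // mulrC.
Qed.

Lemma is_derive_line g x v (t : R) : differentiable g (x + t *: v) ->
  is_derive t 1 (fun s => g (x + s *: v)) (dot (gradient g (x + t *: v)) v).
Proof.
move=> dg.
(* The difference quotients of the restriction to the line are those that
   define the directional derivative. *)
have quotE : (fun h : R => h^-1 *: (g (x + (h *: (1 : R^o) + t) *: v) - g (x + t *: v))) =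
             (fun h => h^-1 *: (g (h *: v + (x + t *: v)) - g (x + t *: v))).
  apply/funext => h; congr (_ *: (g _ - _)).
  by rewrite scalerDl -addrCA /GRing.scale /= mulr1.
apply: DeriveDef; first by rewrite /derivable /= quotE; exact: diff_derivable.
by rewrite -derive_gradient // /derive /= quotE.
Qed.

Lemma convex_strongly_convex g :
  convex_function (setT : set 'rV[R]_d) g -> strongly_convex 0 g.
Proof.
move=> cg t x y /andP[t0 t1].
have := cg (Itv01 t0 t1) x y (in_setT _) (in_setT _).
by rewrite !mul0r subr0.
Qed.

(** No sign is required of mu, so that mu = 0 covers convex functions. *)
Lemma strongly_convex_first_order (mu : R) g x y : 
  differentiable g x -> strongly_convex mu g ->
  g x + dot (gradient g x) (y - x) + mu / 2 * enorm (y - x) ^+ 2 <= g y.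
Proof.
move=> dg sg; set v := y - x.
(* Divide the strong convexity inequality at x + h v by h and let h decrease
   to 0. *)
have cd : h^-1 *: (g (h *: v + x) - g x) @[h --> 0^'+] --> dot (gradient g x) v.
  rewrite -derive_gradient //.
  have := @diff_derivable _ _ _ g x v dg; rewrite /derivable /= => dgv.
  apply: cvg_trans dgv; apply: cvg_app.
  move=> A [e egt0 Ae]; exists e => // h xe xgt0; apply: Ae => //.
  exact/lt0r_neq0.
have cr : g y - g x - mu / 2 * (1 - h) * enorm v ^+ 2 @[h --> (0:R)^'+] -->
    g y - g x - mu / 2 * (1 - 0) * enorm v ^+ 2.
  apply: cvgB; first exact: cvg_cst.
  apply: cvgMl; apply: cvgMr; apply: cvgB; first exact: cvg_cst.
  exact: cvg_at_right_filter.
suff: dot (gradient g x) v <= g y - g x - mu / 2 * (1 - 0) * enorm v ^+ 2.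
  by lra.
apply: (ler_cvg_to cd cr); near=> h.
have h0 : 0 < h by near: h; exact: nbhs_right_gt.
have h1 : h <= 1 by near: h; apply: nbhs_right_le.
have := sg h y x; rewrite (ltW h0) h1 => /(_ isT).
have -> : h *: y + (1 - h) *: x = h *: v + x.
  by rewrite scalerBl scale1r scalerBr addrAC addrA addrC addrA.
rewrite -/v => sgh; rewrite /GRing.scale /= ler_pdivrMl //; lra.
Unshelve. all: by end_near. Qed.

(** The descent lemma: the difference of the two sides at [t *: v] is
    nonincreasing in t for 0 <= t <= 1, its derivative being controlled by the
    Lipschitz bound on the gradient. *)
Lemma smooth_descent (L : R) g x v : smooth_with L g ->
  g (x + v) <= g x + dot (gradient g x) v + L / 2 * enorm v ^+ 2.
Proof.
move=> [L0 dg lip].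
pose p (t : R) := g (x + t *: v) - t * dot (gradient g x) v
  - t ^+ 2 * (L / 2 * enorm v ^+ 2).
pose p' (t : R) := dot (gradient g (x + t *: v) - gradient g x) v
  - t * L * enorm v ^+ 2.
have dp (t : R) : is_derive t (1 : R) p (p' t).
  have dl := is_derive_line g x v t (dg (x + t *: v)).
  apply: is_derive_eq; rewrite /p' !dotE /GRing.scale /=; lra.
have : p 1 <= p 0.
  apply: (@ler0_derive1_le_cc R p 0 1) => // [t|||].
  - rewrite in_itv => /andP[t0 _]; rewrite derive1E derive_val /p' subr_le0.
    apply: le_trans (dot_le_enorm _ _) _.
    have -> : t * L * enorm v ^+ 2 = L * (t * enorm v) * enorm v by ring.
    rewrite ler_wpM2r ?enorm_ge0 //; apply: le_trans (lip _ _) _.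
    by rewrite addrAC subrr add0r enormZ gtr0_norm.
  - apply: derivable_within_continuous => t _; by have := dp t; case.
  - by rewrite in_itv /= lexx ler01.
  - by rewrite in_itv /= lexx ler01.
rewrite /p scale1r scale0r addr0; lra.
Qed.

Lemma infval_le g x : has_lbound (range g) -> infval g <= g x.
Proof. by move=> lb; apply: ge_inf => //; exists x. Qed.

(** The descent lemma along the gradient step of length 1/L: the value there is
    still at least the infimum. *)
Lemma smooth_gradient_gap (L : R) g x : smooth_with L g -> 0 < L ->
  has_lbound (range g) ->
  enorm (gradient g x) ^+ 2 <= 2 * L * (g x - infval g).
Proof.
move=> sg L0 lb.
have := smooth_descent L g x (- L^-1 *: gradient g x) sg.
have := infval_le g (x + - L^-1 *: gradient g x) lb.
rewrite !sqr_enorm !dotE; set q := dot _ _ => h1 h2.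
have h : infval g <= g x - L^-1 / 2 * q.
  apply: le_trans h1 (le_trans h2 _).
  rewrite -subr_ge0.
  have -> : g x - L^-1 / 2 * q - (g x + - L^-1 * q + L / 2 * (- L^-1 * (- L^-1 * q))) = 0.
    by field; rewrite gt_eqF.
  by [].
have -> : q = 2 * L * (L^-1 / 2 * q) by field; rewrite gt_eqF.
rewrite ler_pM2l ?mulr_gt0 //; lra.
Qed.

End Differential.

(** * One step with the stochastic Polyak step size *)

Section Step.
Context {R : realType} {d : nat}.
Implicit Types (g : 'rV[R]_d -> R) (x y z : 'rV[R]_d).

Lemma smooth_withW (L M : R) g : L <= M -> smooth_with L g -> smooth_with M g.
Proof.
move=> LM [L0 dg lip]; split=> // [|x y]; first exact: le_trans LM.
by apply: le_trans (lip x y) _; rewrite ler_wpM2r ?enorm_ge0.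
Qed.

(** For M = 0 the left-hand side is 0, since [1 / 0 = 0]. *)
Lemma sps_max_ge (L M c gamma_b : R) g x :
  smooth_with L g -> L <= M -> has_lbound (range g) -> 0 < c -> 0 < gamma_b ->
  gradient g x != 0 ->
  Num.min (1 / (2 * c * M)) gamma_b <= sps_max c gamma_b g x.
Proof.
move=> sg LM lb c0 gb0 gx0; have M0 : 0 <= M by case: sg => L0 _ _; apply: le_trans LM.
have q0 : 0 < enorm (gradient g x) ^+ 2 by rewrite sqr_enorm dot_gt0.
have gap0 : 0 <= g x - infval g by rewrite subr_ge0 infval_le.
rewrite /sps_max le_min ge_min (ge_min gamma_b) lexx orbT andbT; apply/orP; left.
have [->|Mn0] := eqVneq M 0.
  by rewrite mulr0 invr0 mulr0 divr_ge0 // mulr_ge0 // ltW.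
have {M0} Mn0 : 0 < M by rewrite lt0r Mn0.
rewrite ler_pdivlMr ?(mulr_gt0 c0 q0) // mulrAC ler_pdivrMr ?mulr_gt0 // mul1r.
have := smooth_gradient_gap M g x (smooth_withW _ _ _ LM sg) Mn0 lb.
nra.
Qed.

(** The distance bound for one step on a single summand, in a form that is
    affine in g with constants independent of the step size actually taken. *)
Lemma sps_step_dist (L M c gamma_b : R) g x z :
  convex_function (setT : set 'rV[R]_d) g -> smooth_with L g -> L <= M ->
  has_lbound (range g) -> 1 / 2 <= c -> 0 < gamma_b ->
  enorm (sps_step c gamma_b g x - z) ^+ 2 <=
    enorm (x - z) ^+ 2
    + 2 * Num.min (1 / (2 * c * M)) gamma_b
        * (g x - g z - dot (gradient g x) (x - z))
    + 2 * gamma_b * (g z - infval g).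
Proof.
move=> cg sg LM lb c2 gb0; set a := Num.min _ _.
have c0 : 0 < c by apply: lt_le_trans c2; lra.
have agb : a <= gamma_b by rewrite ge_min lexx orbT.
have gapx : 0 <= g x - infval g by rewrite subr_ge0 infval_le.
have gapz : 0 <= g z - infval g by rewrite subr_ge0 infval_le.
(* By convexity. *)
have D0 : g x - g z - dot (gradient g x) (x - z) <= 0.
  have := strongly_convex_first_order 0 g x z.
  case: (sg) => _ dg _ /(_ (dg x) (convex_strongly_convex _ cg)).
  rewrite -(opprB x z) dotNr; lra.
rewrite /sps_step; case: ifPn => [/eqP gx0|gx0].
  (* The step is trivial, and the last two terms of the bound have a
     nonnegative sum because g x >= inf g and a <= gamma_b. *)
  have dot0 : dot (gradient g x) (x - z) = 0.
    by rewrite gx0 -(scale0r 0) dotZl mul0r.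
  move: D0; rewrite dot0; nra.
have ga := sps_max_ge L M c gamma_b g x sg LM lb c0 gb0 gx0.
have q0 : 0 < enorm (gradient g x) ^+ 2 by rewrite sqr_enorm dot_gt0.
have gam0 : 0 <= sps_max c gamma_b g x.
  by rewrite le_min (ltW gb0) andbT divr_ge0 // mulr_ge0 // ltW.
have gamb : sps_max c gamma_b g x <= gamma_b by rewrite ge_min lexx orbT.
have gamq : sps_max c gamma_b g x * (c * enorm (gradient g x) ^+ 2) <= g x - infval g.
  by rewrite -ler_pdivlMr ?(mulr_gt0 c0 q0) // ge_min lexx.
move: ga gam0 gamb gamq q0; rewrite -/a.
set gam := sps_max _ _ _ _ => ga gam0 gamb gamq q0.
have -> : x - gam *: gradient g x - z = (x - z) - gam *: gradient g x by rewrite addrAC.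
move: q0 gamq D0; rewrite !sqr_enorm !(dotDl (x - z)) !(dotDr _ (- (_ *: _))) !dotNl !dotNr.
rewrite !dotZl !dotZr (dotC (x - z) (gradient g x)).
set q := dot (gradient g x) (gradient g x); set s := dot (gradient g x) (x - z).
set r := dot (x - z) (x - z) => q0 gamq D0.
(* Here 1/2 <= c is used. *)
have gamq' : gam * q <= 2 * (g x - infval g) by nra.
have h1 : gam * (gam * q) <= gam * (2 * (g x - infval g)) by rewrite ler_wpM2l.
have h2 : gam * (g z - infval g) <= gamma_b * (g z - infval g) by rewrite ler_wpM2r.
have h3 : gam * (g x - g z - s) <= a * (g x - g z - s) by rewrite ler_wnM2r.
nra.
Qed.

End Step.

(** * Gradient of the average *)

Section Average.
Context {R : realType} {d n : nat}.
Variable f : 'I_n -> 'rV[R]_d -> R.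
Implicit Types (x y z v : 'rV[R]_d).

Lemma averageE : average f = n%:R^-1 *: \sum_(i < n) f i.
Proof. by apply/funext => x; rewrite /average fctE fct_sumE. Qed.

Lemma differentiable_average x :
  (forall i, differentiable (f i) x) -> differentiable (average f) x.
Proof.
by move=> df; rewrite averageE; apply: differentiableZ; apply: differentiable_sum.
Qed.

Lemma dot_gradient_average x v : (forall i, differentiable (f i) x) ->
  dot (gradient (average f) x) v = n%:R^-1 * \sum_(i < n) dot (gradient (f i) x) v.
Proof.
move=> df; rewrite -derive_gradient; last exact: differentiable_average.
have dv i : derivable (f i) x v by apply: diff_derivable.
rewrite averageE deriveZ; last exact: derivable_sum.
rewrite derive_sum //; congr (_ * _).
by apply: eq_bigr => i _; rewrite derive_gradient.
Qed.

End Average.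

(** * Chains driven by independent uniform draws *)

(** [Y] is any sequence of random elements of [S] obtained from a deterministic
    [s0] by applying at time k the map [F i] selected by the draw [i = I k].  No
    structure is needed on [S]: [Y k] takes finitely many values. *)
Section Chain.
Context {R : realType} {disp : measure_display} {T : measurableType disp}.
Variables (P : probability T R) (n : nat) (I : nat -> T -> 'I_n).
Hypothesis iidI : iid_uniform P I.
Variables (S : Type) (F : 'I_n -> S -> S) (s0 : S) (Y : nat -> T -> S).
Hypothesis Y0 : forall w, Y 0%N w = s0.
Hypothesis YS : forall k w, Y k.+1 w = F (I k w) (Y k w).

Lemma measurable_chain k (A : set S) : measurable (Y k @^-1` A).
Proof.
case: iidI => mI _ _; elim: k A => [|k IH] A.
  have [As0|As0] := pselect (A s0).
    by rewrite (_ : _ @^-1` _ = setT) //; apply/seteqP; split=> // w _ /=; rewrite Y0.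
  by rewrite (_ : _ @^-1` _ = set0) //; apply/seteqP; split=> // w /=; rewrite Y0.
rewrite (_ : _ @^-1` _ =
    \bigcup_(i in [set: 'I_n]) (I k @^-1` [set i] `&` Y k @^-1` (F i @^-1` A))).
  apply: fin_bigcup_measurable => [|i _]; first exact: finite_finset.
  by apply: measurableI; [exact: mI|exact: IH].
apply/seteqP; split=> [w /= |w [i _ /= [<-]]]; rewrite YS // => Aw.
by exists (I k w).
Qed.

Lemma measurable_fun_chain k (Psi : S -> R) :
  measurable_fun [set: T] (fun w => Psi (Y k w)).
Proof.
move=> _ B mB; rewrite setTI.
exact: (measurable_chain k (Psi @^-1` B)).
Qed.

(** Splitting an integral according to the value of the draw number k. *)
Lemma integral_split k (B : set T) (g : T -> R) : measurable B ->
  measurable_fun B g -> (forall w, 0 <= g w) ->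
  (\int[P]_(w in B) (g w)%:E =
   \sum_(i < n) \int[P]_(w in B `&` I k @^-1` [set i]) (g w)%:E)%E.
Proof.
case: iidI => mI _ _ mB mg g0.
have BE : \big[setU/set0]_(i <- index_enum 'I_n) (B `&` I k @^-1` [set i]) = B.
  rewrite -bigcup_seq; apply/seteqP; split=> [w [i _ []] //|w Bw].
  by exists (I k w) => //=; rewrite mem_index_enum.
rewrite -{1}BE ge0_integral_bigsetU ?BE //.
- by move=> i; apply: measurableI.
- exact: index_enum_uniq.
- by move=> i j _ _ [w [[_ /= <-] [_ /= <-]]].
- exact/measurable_EFinP.
- by move=> w _; rewrite lee_fin.
Qed.

(** [Y k] is independent of every event that constrains finitely many draws of
    index at least k.  In the induction, the draw number k moves from the map
    that produces [Y k.+1] to the event. *)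
Lemma chain_future_indep k (Psi : S -> R) (s : seq nat) (A : nat -> set 'I_n) :
  (forall x, 0 <= Psi x) -> uniq s -> all (leq k) s ->
  let B := \bigcap_(j in [set` s]) (I j @^-1` A j) in
  (\int[P]_(w in B) (Psi (Y k w))%:E = P B * \int[P]_w (Psi (Y k w))%:E)%E.
Proof.
case: (iidI) => mI uI pI.
elim: k Psi s A => [|k IH] Psi s A Psi0 us ks B.
  have mB : measurable B.
    by apply: fin_bigcap_measurable => [|i _]; [exact: finite_seq|exact: mI].
  under eq_integral do rewrite Y0.
  under [in RHS]eq_integral do rewrite Y0.
  rewrite !integral_cst //= probability_setT mule1 muleC //.
(* The integral over the event factors as its probability times a quantity
   that does not depend on the event; the event setT identifies that quantity. *)
have step s' A' : uniq s' -> all (leq k.+1) s' ->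
    let B' := \bigcap_(j in [set` s']) (I j @^-1` A' j) in
    (\int[P]_(w in B') (Psi (Y k.+1 w))%:E =
     P B' * (\sum_(i < n) n%:R^-1%:E * \int[P]_w (Psi (F i (Y k w)))%:E))%E.
  move=> us' ks' B'.
  have mB' : measurable B'.
    by apply: fin_bigcap_measurable => [|i _]; [exact: finite_seq|exact: mI].
  have kns' : k \notin s'.
    by apply/negP => /(allP ks'); rewrite ltnn.
  rewrite (integral_split k) //; last first.
    by apply: measurable_funTS; exact: measurable_fun_chain.
  rewrite ge0_sume_distrr; last first.
    by move=> i _; rewrite mule_ge0 ?lee_fin ?invr_ge0 // integral_ge0 // => w _; rewrite lee_fin.
  apply: eq_bigr => i _.
  (* The event B' with the extra constraint that draw number k equals i. *)
  pose A'' j := if j == k then [set i] else A' j.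
  have B''E : B' `&` I k @^-1` [set i] =
      \bigcap_(j in [set` k :: s']) (I j @^-1` A'' j).
    apply/seteqP; split=> [w [Bw /= Iw] j|w Bw].
      rewrite /= inE /A''; case: eqP => [->//|_ /= js']; exact: Bw.
    split=> [j /= js'|]; last first.
      by have := Bw k; rewrite /= inE eqxx /A'' eqxx; apply.
    have := Bw j; rewrite /= inE js' orbT => /(_ isT).
    by rewrite /A''; case: eqP js' kns' => // -> ->.
  have PB'' : P (\bigcap_(j in [set` k :: s']) (I j @^-1` A'' j)) = (P B' * n%:R^-1%:E)%E.
    rewrite pI /= ?kns' // big_cons {1}/A'' eqxx uI muleC pI //; congr (_ * _)%E.
    apply: eq_big_seq => j js'; rewrite /A''; case: eqP js' kns' => // -> -> //.
  rewrite B''E; transitivity (\int[P]_(w in \bigcap_(j in [set` k :: s']) (I j @^-1` A'' j))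
    (Psi (F i (Y k w)))%:E)%E.
    by rewrite -B''E; apply: eq_integral => w; rewrite inE => -[_ /= Iw]; rewrite YS Iw.
  rewrite (IH (Psi \o F i)) ?PB'' ?muleA //=; first by rewrite kns'.
  by rewrite leqnn /=; apply: sub_all ks' => j; exact: ltnW.
rewrite step //; congr (_ * _)%E.
have := step [::] A isT isT; rewrite /= set_nil bigcap_set0 probability_setT mul1e.
by move=> ->.
Qed.

(** Conditioning on the past, in expectation: given [Y k], the next draw is
    still uniform. *)
Lemma expectation_chainS k (Psi : S -> R) : (forall x, 0 <= Psi x) ->
  ('E_P[fun w => Psi (Y k.+1 w)] =
   'E_P[fun w => (n%:R^-1 * \sum_(i < n) Psi (F i (Y k w)))%R])%E.
Proof.
case: (iidI) => mI uI pI Psi0; rewrite unlock.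
rewrite (integral_split k) //; last exact: measurable_fun_chain.
under [RHS]eq_integral do rewrite mulr_sumr -sumEFin.
rewrite ge0_integral_sum //=; last 2 first.
- move=> i; apply/measurable_EFinP.
  exact: (measurable_fun_chain k (fun x => n%:R^-1 * Psi (F i x))).
- by move=> i w _; rewrite lee_fin mulr_ge0.
apply: eq_bigr => i _.
have indep := chain_future_indep k (Psi \o F i) [:: k] (fun=> [set i]).
transitivity (\int[P]_(w in I k @^-1` [set i]) (Psi (F i (Y k w)))%:E)%E.
  by rewrite setTI; apply: eq_integral => w; rewrite inE /= => Iw; rewrite YS Iw.
move: indep; rewrite /= set_cons1 bigcap_set1 leqnn uI => ->//.
under [RHS]eq_integral do rewrite EFinM.
rewrite ge0_integralZl //; last by move=> w _; exact: Psi0.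
apply/measurable_EFinP; exact: (measurable_fun_chain k (Psi \o F i)).
Qed.

End Chain.

(** * Contraction in mean squared distance *)

Section Contraction.
Context {R : realType} {d n : nat}.
Variables (f : 'I_n -> 'rV[R]_d -> R) (L : 'I_n -> R) (mu : R).
Hypothesis n_gt0 : (0 < n)%N.
Hypothesis f_smooth : forall i, smooth_with (L i) (f i).
Hypothesis f_sc : strongly_convex mu (average f).
Implicit Types (x y z : 'rV[R]_d).

Lemma Lmax_ge i : L i <= Lmax L.
Proof. exact: le_bigmax. Qed.

Lemma Lmax_ge0 : 0 <= Lmax L.
Proof. exact: bigmax_ge_id. Qed.

Lemma average_const (a : R) : n%:R^-1 * \sum_(i < n) a = a.
Proof.
by rewrite sumr_const card_ord -[a *+ n]mulr_natl mulKf // pnatr_eq0 -lt0n.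
Qed.

Lemma le_average (a b : 'I_n -> R) : (forall i, a i <= b i) ->
  n%:R^-1 * \sum_(i < n) a i <= n%:R^-1 * \sum_(i < n) b i.
Proof. by move=> ab; rewrite ler_wpM2l ?invr_ge0 //; apply: ler_sum. Qed.

(** Strong convexity bounds <grad f u - grad f 0, u> below by mu |u|^2, and
    smoothness bounds it above by Lmax |u|^2. *)
Lemma strong_convexity_le_Lmax (u : 'rV[R]_d) : u != 0 -> mu <= Lmax L.
Proof.
move=> u0; have df i x : differentiable (f i) x by case: (f_smooth i).
have dav x := differentiable_average f x (fun i => df i x).
have h1 := strongly_convex_first_order mu _ 0 u (dav 0) f_sc.
have h2 := strongly_convex_first_order mu _ u 0 (dav u) f_sc.
have h : dot (gradient (average f) u) u - dot (gradient (average f) 0) u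
    <= Lmax L * dot u u.
  rewrite !dot_gradient_average // -mulrBr -sumrB.
  rewrite -[leRHS]average_const; apply: le_average => i.
  have [_ _ lip] := smooth_withW _ _ _ (Lmax_ge i) (f_smooth i).
  rewrite -dotNl -dotDl; apply: le_trans (dot_le_enorm _ _) _.
  rewrite -sqr_enorm expr2 mulrA ler_wpM2r ?enorm_ge0 //.
  by have := lip u 0; rewrite subr0.
move: h1 h2; rewrite subr0 sub0r !dotNr enormN sqr_enorm.
have := dot_gt0 u u0; nra.
Qed.

Variables (c gamma_b : R) (xstar : 'rV[R]_d).
Hypothesis f_convex : forall i, convex_function (setT : set 'rV[R]_d) (f i).
Hypothesis f_lb : forall i, has_lbound (range (f i)).
Hypothesis c_ge : 1 / 2 <= c.
Hypothesis gamma_b_gt0 : 0 < gamma_b.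

Lemma sps_c_gt0 : 0 < c.
Proof. by apply: lt_le_trans c_ge; lra. Qed.

Lemma sigma2_ge0 : 0 <= sigma2 f xstar.
Proof.
rewrite mulr_ge0 ?invr_ge0 // sumr_ge0 // => i _.
by rewrite subr_ge0 infval_le.
Qed.

Lemma sps_step_contraction x :
  n%:R^-1 * \sum_(i < n) enorm (sps_step c gamma_b (f i) x - xstar) ^+ 2 <=
    (1 - mu * sps_alpha c gamma_b L) * enorm (x - xstar) ^+ 2
    + 2 * gamma_b * sigma2 f xstar.
Proof.
have df i x' : differentiable (f i) x' by case: (f_smooth i).
apply: le_trans (le_average _ _ (fun i => sps_step_dist _ _ _ _ _ x xstar
  (f_convex i) (f_smooth i) (Lmax_ge i) (f_lb i) c_ge gamma_b_gt0)) _.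
rewrite !big_split /= !mulrDr average_const -!mulr_sumr -/(sps_alpha c gamma_b L) !sumrB.
have := strongly_convex_first_order mu _ x xstar
  (differentiable_average f x (fun i => df i x)) f_sc.
have -> : xstar - x = - (x - xstar) by rewrite opprB.
rewrite dotNr enormN dot_gradient_average // {1 2}/average.
rewrite /sigma2 sumrB.
have : 0 <= sps_alpha c gamma_b L.
  rewrite le_min (ltW gamma_b_gt0) andbT divr_ge0 // !mulr_ge0 ?Lmax_ge0 //; exact: ltW sps_c_gt0.
set a := sps_alpha _ _ _; set e := enorm _; set s1 := \sum_(i < n) f i x.
set s2 := \sum_(i < n) f i xstar; set s3 := \sum_(i < n) infval (f i).
set s4 := \sum_(i < n) dot _ _; set m := n%:R^-1.
move=> a0 h.
have := ler_wpM2l a0 h; lra.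
Qed.

Lemma sps_alpha_gt0 : 0 < Lmax L -> 0 < sps_alpha c gamma_b L.
Proof.
by move=> L0; rewrite lt_min gamma_b_gt0 andbT divr_gt0 ?mulr_gt0 ?sps_c_gt0.
Qed.

Lemma mu_sps_alpha_le1 : 0 < mu -> mu <= Lmax L -> mu * sps_alpha c gamma_b L <= 1.
Proof.
move=> mu0 muL; have L0 := lt_le_trans mu0 muL.
have cL0 : 0 < 2 * c * Lmax L by rewrite !mulr_gt0 ?sps_c_gt0.
have : sps_alpha c gamma_b L <= 1 / (2 * c * Lmax L) by rewrite ge_min lexx.
rewrite ler_pdivlMr // => h.
have a0 := sps_alpha_gt0 L0.
apply: le_trans h; rewrite mulrC ler_wpM2l ?(ltW a0) //.
apply: le_trans muL _; rewrite ler_peMl ?(ltW L0) //; have := c_ge; lra.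
Qed.

(** For [Lmax L = 0] both sides are 0. *)
Lemma sps_alpha_le_half : sps_alpha c gamma_b L <= sps_alpha (1 / 2) gamma_b L.
Proof.
have [L0|L0] := eqVneq (Lmax L) 0; first by rewrite /sps_alpha L0 !mulr0.
have {}L0 : 0 < Lmax L by rewrite lt0r L0 Lmax_ge0.
rewrite le_min (ge_min gamma_b) lexx orbT andbT ge_min; apply/orP; left.
rewrite ler_pM2l ?ltr01 // lef_pV2 ?posrE ?mulr_gt0 ?sps_c_gt0 //.
rewrite ler_pM2r //; have := c_ge; lra.
Qed.

End Contraction.

(** * The convergence theorem *)

Lemma expectation_affine_le {R : realType} {disp : measure_display}
  {T : measurableType disp} (P : probability T R) (X Z : T -> R) (r b : R) :
  measurable_fun setT X -> measurable_fun setT Z ->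
  (forall w, 0 <= X w) -> (forall w, 0 <= Z w) -> 0 <= r -> 0 <= b ->
  (forall w, Z w <= r * X w + b) ->
  ('E_P[Z] <= r%:E * 'E_P[X] + b%:E)%E.
Proof.
move=> mX mZ X0 Z0 r0 b0 ZX; rewrite unlock.
apply: (@le_trans _ _ (\int[P]_w (r%:E * (X w)%:E + b%:E))%E).
  apply: ge0_le_integral => //.
  - by move=> w _; rewrite lee_fin.
  - exact/measurable_EFinP.
  - by apply: emeasurable_funD => //; apply: measurable_funeM; exact/measurable_EFinP.
  - by move=> w _; rewrite -EFinM -EFinD lee_fin.
rewrite ge0_integralD //=; last 2 first.
- by move=> w _; rewrite lee_fin mulr_ge0.
- by apply: measurable_funeM; exact/measurable_EFinP.
rewrite integral_cst //= probability_setT mule1 ge0_integralZl //.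
- exact/measurable_EFinP.
- by move=> w _; rewrite lee_fin.
Qed.

Theorem theorem3p1 (R : realType) (d n : nat) (n_gt0 : (0 < n)%N)
    (f : 'I_n -> 'rV[R]_d -> R) (L : 'I_n -> R) (mu : R) (xstar : 'rV[R]_d)
    (gamma_b : R)
    (f_convex : forall i, convex_function (setT : set 'rV[R]_d) (f i))
    (f_smooth : forall i, smooth_with (L i) (f i))
    (f_bounded_below : forall i, has_lbound (range (f i)))
    (mu_gt0 : 0 < mu)
    (favg_strongly_convex : strongly_convex mu (average f))
    (xstar_min : minimizer (average f) xstar)
    (gamma_b_gt0 : 0 < gamma_b) :
  (forall c : R, 1 / 2 <= c ->
    forall (disp : measure_display) (T : measurableType disp)
      (P : probability T R) (I : nat -> T -> 'I_n),
    iid_uniform P I ->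
    forall (x0 : 'rV[R]_d) (k : nat),
    ('E_P[fun w => (enorm (sps_sgd f c gamma_b x0 (I ^~ w) k - xstar) ^+ 2)%R]
      <= ((1 - mu * sps_alpha c gamma_b L) ^+ k * enorm (x0 - xstar) ^+ 2
          + 2 * gamma_b * sigma2 f xstar / (mu * sps_alpha c gamma_b L))%:E)%E)
  /\
  (forall c : R, 1 / 2 <= c ->
    1 - mu * sps_alpha (1 / 2) gamma_b L <= 1 - mu * sps_alpha c gamma_b L /\
    2 * gamma_b * sigma2 f xstar / (mu * sps_alpha (1 / 2) gamma_b L)
      <= 2 * gamma_b * sigma2 f xstar / (mu * sps_alpha c gamma_b L)).
Proof.
have s2 := sigma2_ge0 f xstar f_bounded_below.
have b0 : 0 <= 2 * gamma_b * sigma2 f xstar.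
  by rewrite mulr_ge0 // mulr_ge0 // ltW.
(* The comparison with c = 1/2 first: it only uses monotonicity of alpha. *)
split=> c c_ge; last first.
  have aW := sps_alpha_le_half L c gamma_b c_ge.
  have muaW : mu * sps_alpha c gamma_b L <= mu * sps_alpha (1 / 2) gamma_b L.
    by rewrite ler_pM2l.
  split; first by rewrite lerD2l lerN2.
  have [a0|a0] := eqVneq (sps_alpha c gamma_b L) 0.
    have [L0|L0] := eqVneq (Lmax L) 0; first by rewrite /sps_alpha L0 !mulr0.
    have : 0 < sps_alpha c gamma_b L.
      by apply: sps_alpha_gt0 => //; rewrite lt0r L0 Lmax_ge0.
    by rewrite a0 ltxx.
  have {}a0 : 0 < sps_alpha c gamma_b L.
    rewrite lt0r a0 le_min (ltW gamma_b_gt0) andbT divr_ge0 // !mulr_ge0 ?Lmax_ge0 //.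
    exact: ltW (sps_c_gt0 c c_ge).
  rewrite ler_wpM2l // lef_pV2 // posrE mulr_gt0 //; exact: lt_le_trans aW.
move=> disp T P I iidI x0 k.
pose Y k w := sps_sgd f c gamma_b x0 (I ^~ w) k.
(* Either the space has a nonzero vector, or d = 0 and every norm is 0. *)
have [[u u0]|all0] := pselect (exists u : 'rV[R]_d, u != 0); last first.
  have {}all0 (u : 'rV[R]_d) : enorm u = 0.
    have [->|u0] := eqVneq u 0; last by case: all0; exists u.
    by rewrite -(scale0r 0) enormZ normr0 mul0r.
  under [X in ('E_P[X])%E]eq_fun do rewrite all0 expr0n.
  have -> : (fun=> (0 : R)) = cst 0 by [].
  rewrite expectation_cst lee_fin all0 expr0n mulr0 add0r divr_ge0 //.
  rewrite mulr_ge0 ?(ltW mu_gt0) // le_min (ltW gamma_b_gt0) andbT.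
  by rewrite divr_ge0 // !mulr_ge0 ?Lmax_ge0 // ltW // (sps_c_gt0 c c_ge).
have muL := strong_convexity_le_Lmax f L mu n_gt0 f_smooth favg_strongly_convex u u0.
have L0 := lt_le_trans mu_gt0 muL.
have a0 := sps_alpha_gt0 L c gamma_b c_ge gamma_b_gt0 L0.
have a1 := mu_sps_alpha_le1 L mu c gamma_b c_ge gamma_b_gt0 mu_gt0 muL.
have ma0 : 0 < mu * sps_alpha c gamma_b L by rewrite mulr_gt0.
set r := 1 - mu * sps_alpha c gamma_b L.
have r0 : 0 <= r by rewrite subr_ge0.
set b := 2 * gamma_b * sigma2 f xstar in b0 *.
pose Psi x : R := enorm (x - xstar) ^+ 2.
have Psi0 x : 0 <= Psi x by exact: sqr_ge0.
have mY Phi k' : measurable_fun setT (fun w => Phi (Y k' w) : R).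
  exact: (measurable_fun_chain P n I iidI _ (fun i => sps_step c gamma_b (f i)) x0 Y).
elim: k => [|k IH].
  rewrite expr0 mul1r.
  have -> : (fun w => enorm (sps_sgd f c gamma_b x0 (I ^~ w) 0 - xstar) ^+ 2) =
    cst (enorm (x0 - xstar) ^+ 2) by [].
  by rewrite expectation_cst lee_fin lerDl divr_ge0 // ltW.
have := expectation_chainS P n I iidI _ (fun i => sps_step c gamma_b (f i)) x0 Y
  (fun=> erefl) (fun _ _ => erefl) k Psi Psi0.
rewrite /Psi /Y => ->.
apply: (@le_trans _ _ (r%:E * 'E_P[fun w => Psi (Y k w)] + b%:E)%E).
  apply: expectation_affine_le => //.
  - exact: (mY (fun x => n%:R^-1 *
      \sum_(i < n) enorm (sps_step c gamma_b (f i) x - xstar) ^+ 2)).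
  - by move=> w; apply: mulr_ge0; [rewrite invr_ge0|apply: sumr_ge0 => i _; exact: sqr_ge0].
  - by move=> w; apply: sps_step_contraction.
apply: (@le_trans _ _ (r%:E * (r ^+ k * enorm (x0 - xstar) ^+ 2
          + b / (mu * sps_alpha c gamma_b L))%:E + b%:E)%E).
  by rewrite leeD2r // lee_wpmul2l ?lee_fin.
rewrite -EFinM -EFinD lee_fin (exprS r) -(mulrA r).
(* The bound b / (mu alpha) is the fixed point of t |-> r t + b. *)
have : b / (mu * sps_alpha c gamma_b L) * (mu * sps_alpha c gamma_b L) = b.
  by rewrite divfK // gt_eqF.
move: (r ^+ k * _) (b / _) => q D Db.
by rewrite mulrDr -addrA lerD2l -{1}Db /r; lra.
Qed.
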